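(* Let $\mathcal{X}$ be a set, let $E$ be a Banach space, and let $\mathcal{B}$ be a vector space of functions $f:\mathcal{X}\to E$ with pointwise addition and scalar multiplication, endowed with a norm $\|\cdot\|_{\mathcal{B}}$. Then $\mathcal{B}$ is a generalized reproducing kernel Banach space (GRKBS) if and only if there exist a Banach space $\mathcal{F}$ and a mapping $\phi:\mathcal{X}\to L_{\mathrm{op}}(\mathcal{F},E)$ such that $$\mathcal{B}=\{f_\mu:\mu\in\mathcal{F}\},\qquad\text{where } f_\mu(x)=\phi(x)(\mu)\ \text{ for all } x\in\mathcal{X},\ \mu\in\mathcal{F},$$ and $$\|f\|_{\mathcal{B}}=\inf\{\|\mu\|_{\mathcal{F}}:\mu\in\mathcal{F},\ f=f_\mu\}\qquad\text{for all } f\in\mathcal{B}.$$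
   Context: $L_{\mathrm{op}}(\mathcal{F},E)$ denotes the space of bounded linear operators from $\mathcal{F}$ to $E$. A generalized reproducing kernel Banach space (GRKBS) is a Banach space $\mathcal{B}$ of functions $f:\mathcal{X}\to E$ (with pointwise addition and scalar multiplication) such that for every $x\in\mathcal{X}$ the evaluation operator $ev_x:\mathcal{B}\to E$, $ev_x(f)=f(x)$, is bounded, i.e. $ev_x\in L_{\mathrm{op}}(\mathcal{B},E)$. The set $\mathcal{X}$ is arbitrary, with no structure assumed. *)

(* Defs.v *)
From HB Require Import structures.
From mathcomp Require Import all_boot all_order all_algebra.
From mathcomp Require Import mathcomp_extra boolp classical_sets functions.
From mathcomp Require Import reals topology normedtype.
From mathcomp Require Import complex.

Set Implicit Arguments.
Unset Strict Implicit.
Unset Printing Implicit Defensive.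

Import Order.TTheory GRing.Theory Num.Theory.
Import numFieldNormedType.Exports.

Local Open Scope classical_set_scope.
Local Open Scope ring_scope.

(* Norms of vector spaces over K take their values in K, so a complex Banach
   space has a norm with values in R[i]; there `0 <= z` forces z to be real. *)
Definition real_or_complex (K : numFieldType) : Prop :=
  exists R : realType, K = (R : numFieldType) \/ K = (R[i] : numFieldType).

Section Norms.
Variables (K : numFieldType) (V : lmodType K).

Record norm_on := NormOn {
  norm_fun :> V -> K;
  norm_triangle : forall x y, norm_fun (x + y) <= norm_fun x + norm_fun y;
  norm_homogeneous : forall (a : K) x, norm_fun (a *: x) = `|a| * norm_fun x;
  norm_definite : forall x, norm_fun x = 0 -> x = 0 }.

(* The space V itself, carrying the topology of the norm nu. *)
Definition normed_by of norm_on : Type := V.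

HB.instance Definition _ (nu : norm_on) := GRing.Lmodule.on (normed_by nu).
HB.instance Definition _ (nu : norm_on) :=
  Lmodule_isNormed.Build K (normed_by nu)
    (norm_triangle nu) (norm_homogeneous nu) (@norm_definite nu).

Lemma normed_byE (nu : norm_on) (v : normed_by nu) : `|v| = nu v.
Proof. by []. Qed.

End Norms.

(* The condition required by the completeType interface. *)
Definition complete_space (T : puniformType) : Prop :=
  forall F : set_system T, ProperFilter F -> cauchy F -> cvg F.

Definition Lop (K : numFieldType) (V W : normedModType K) : set (V -> W) :=
  [set f | linear f /\ exists C : K, forall v, `|f v| <= C * `|v|].

Arguments Lop {K} V W _.

Section FunctionSpaces.
Variables (K : numFieldType) (X : Type) (E : normedModType K).

(* A vector space of functions is a linear subspace B of X -> E, whose vector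
   space structure is the pointwise one; fun_space B is B as a type. *)
Definition fun_space (B : submodClosed (X -> E)) : Type := {f : X -> E | f \in B}.

HB.instance Definition _ B := SubChoice.on (fun_space B).
HB.instance Definition _ B :=
  [SubChoice_isSubLmodule of fun_space B by <:].

Definition ev (B : submodClosed (X -> E)) (x : X) (f : fun_space B) : E :=
  \val f x.

Definition is_GRKBS (B : submodClosed (X -> E)) (nu : norm_on (fun_space B)) :
    Prop :=
  complete_space (normed_by nu) /\
  forall x : X, Lop (normed_by nu) E (ev x).

Definition feature_fun (F : normedModType K) (phi : X -> Lop F E) (mu : F) :
  X -> E := fun x => \val (phi x) mu.

End FunctionSpaces.

(* Main.v *)
(* A GRKBS is its own feature space, with feature map x |-> ev_x.  Conversely,
   mu |-> f_mu maps F onto B, and the norm of B is the quotient norm; hence B is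
   complete, and a bound on phi x passes to ev_x by taking the infimum over the
   representatives mu of f. *)
Require Import Defs.
From HB Require Import structures.
From mathcomp Require Import all_boot all_order all_algebra.
From mathcomp Require Import mathcomp_extra boolp classical_sets functions.
From mathcomp Require Import reals topology normedtype.
From mathcomp Require Import complex ring.

Import Order.TTheory GRing.Theory Num.Theory.
Import numFieldNormedType.Exports.

Local Open Scope classical_set_scope.
Local Open Scope ring_scope.

Lemma exp_half_lt_archi (R : archiRealFieldType) (e : R) :
  0 < e -> exists n : nat, 2^-1 ^+ n < e.
Proof.
move=> e0; have ei0 : 0 <= e^-1 by rewrite invr_ge0 ltW.
(* With [n] this bound, [e^-1 < n < 2 ^ n]. *)
exists (Num.bound e^-1).
rewrite exprVn -[ltRHS]invrK ltf_pV2 ?posrE ?invr_gt0 ?exprn_gt0//.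
by rewrite (lt_trans (archi_boundP ei0))// -natrX ltr_nat ltn_expl.
Qed.

(** In [R[i]], [0 < e] forces the imaginary part of [e] to vanish, so the complex case reduces to
    the Archimedean property of [R]. *)
Lemma exp_half_lt (K : numFieldType) (e : K) : real_or_complex K ->
  0 < e -> exists n : nat, 2^-1 ^+ n < e.
Proof.
move=> [R hK]; case: hK e => -> e; first exact: exp_half_lt_archi.
case: e => a b; rewrite ltcE/= => /andP[/eqP -> /exp_half_lt_archi[n hn]].
exists n; have -> : (2 : R[i]) = (2 : R)%:C%C by rewrite rmorph_nat.
by rewrite -fmorphV -rmorphXn -[X in _ < X]/(a%:C%C) ltcR.
Qed.

Lemma quotient_complete (K : numFieldType) (hK : real_or_complex K)
    (F : completeNormedModType K) (V : normedModType K) (T : {linear F -> V}) :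
  (forall mu, `|T mu| <= `|mu|) ->
  (forall v c, `|v| < c -> exists mu, T mu = v /\ `|mu| < c) ->
  complete_space V.
Proof.
move=> Tle Tlift G GP /cauchyP Gc.
(* The increments of a sequence u that approximates G geometrically fast lift to
   a summable series m in F; the image under T of its sum is the limit of G. *)
pose r n : K := 2^-1 ^+ n.
have r0 n : 0 < r n by rewrite exprn_gt0 ?invr_gt0.
have rS n : r n = 2 * r n.+1 by rewrite /r exprS mulrA divff ?mul1r ?pnatr_eq0.
have /(@choice _ _ (fun n x => G (ball x (r n))))[u uG] :
    forall n, exists x, G (ball x (r n)).
  by move=> n; exact: Gc.
have uS n : `|u n.+1 - u n| < 2 * r n.
  have [x []] := filter_ex (filterI (uG n) (uG n.+1)).
  rewrite -ball_normE /ball_/= => h1 h2.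
  rewrite distrC (le_lt_trans (ler_distD x _ _))//.
  rewrite [X in _ + X]distrC (lt_le_trans (ltrD h1 h2))//.
  by rewrite mulrDl mul1r lerD2l [leRHS]rS mulrDl mul1r lerDl ltW.
have /(@choice _ _ (fun n mu => _ /\ _))[m mP] :
    forall n, exists mu, T mu = u n.+1 - u n /\ `|mu| < 2 * r n.
  by move=> n; exact: Tlift.
(* A lift of the initial term: the partial sums started at [m0] telescope under [T] to [u]
   itself. *)
have [m0 [Tm0 _]] : exists mu, T mu = u 0%N /\ `|mu| < `|u 0%N| + 1.
  by apply: Tlift; rewrite ltrDl.
pose S n := m0 + \sum_(i < n) m i.
have TS n : T (S n) = u n.
  rewrite linearD linear_sum Tm0.
  elim: n => [|n IHn]; first by rewrite big_ord0 addr0.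
  by rewrite big_ord_recr/= addrA IHn (mP n).1 addrC subrK.
(* The right side is the exact value of the geometric sum of [2 * r i] for [n <= i < n + k]; keeping
   the subtracted term lets the induction close. *)
have S_le n k : `|S (n + k)%N - S n| <= 4 * (r n - r (n + k)%N).
  elim: k => [|k IHk]; first by rewrite addn0 !subrr normr0 mulr0.
  rewrite addnS (le_trans (ler_distD (S (n + k)%N) _ _))//.
  have -> : S (n + k).+1 - S (n + k)%N = m (n + k)%N.
    by rewrite /S big_ord_recr/= addrA [X in X - _]addrC addrK.
  rewrite (le_trans (lerD (ltW (mP _).2) IHk))//.
  rewrite [r (n + k)%N]rS -subr_ge0.
  set a := r _.+1; set b := r n.
  by have -> : 4 * (b - a) - (2 * (2 * a) + 4 * (b - 2 * a)) = 0 by ring.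
have S_lt n k : `|S (n + k)%N - S n| < 4 * r n.
  by rewrite (le_lt_trans (S_le _ _))// ltr_pM2l// ltrBlDr ltrDl.
have /cauchy_cvgP : cauchy (S @ \oo).
  apply: cauchy_exP => e e0.
  have [n hn] : exists n, r n < e / 4 by apply: exp_half_lt; rewrite ?divr_gt0.
  exists (S n); exists n => // k /= nk; rewrite -ball_normE /ball_/= distrC.
  rewrite -(subnKC nk) (lt_trans (S_lt _ _))//.
  by rewrite mulrC -ltr_pdivlMr.
move=> /cvg_ex[l /= Sl]; apply/cvg_ex; exists (T l).
move=> A /nbhs_ballP[e /= e0 eA].
(* The 6 splits as 4 for the tail of [S] after [n], 1 for the distance from a late partial sum to
   [l], and 1 for the radius of the ball around [u n]. *)
have [n hn] : exists n, r n < e / 6 by apply: exp_half_lt; rewrite ?divr_gt0.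
have ln : `|l - S n| < 5 * r n.
  have /cvgrPdist_lt/(_ _ (r0 n))[N _ hN] := Sl.
  rewrite (le_lt_trans (ler_distD (S (n + N)%N) _ _))//.
  have -> : 5 = 1 + 4 :> K by rewrite -(natrD _ 1 4).
  by rewrite mulrDl mul1r ltrD// hN//= leq_addl.
apply: filterS (uG n) => x; rewrite -ball_normE /ball_/= => ux.
apply: eA; rewrite -ball_normE /ball_/=.
rewrite (le_lt_trans (ler_distD (u n) _ _))//.
rewrite ltr_pdivlMr// mulrC in hn; apply: lt_trans hn.
have -> : 6 = 5 + 1 :> K by rewrite -(natrD _ 5 1).
by rewrite mulrDl mul1r ltrD// (le_lt_trans _ ln)// -TS -linearB Tle.
Qed.

(** The order of [K] may be partial, so the usual argument by contradiction first needs [c] to be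
    real: it is comparable with [s], and [s] with the norm of a point of [A]. *)
Lemma infimums_norm_lt (K : numFieldType) (V : normedModType K) (A : set V)
    (s c : K) :
  infimums [set `|v| | v in A] s -> s < c -> A !=set0 ->
  exists2 v, A v & `|v| < c.
Proof.
move=> [slb sglb] sc [v0 Av0]; apply: contrapT => noA.
have c_real : c \is Num.real.
  have sv0 : s <= `|v0| by apply: slb; exists v0.
  by rewrite -(ler_real (ltW sc)) (ler_real sv0) normr_real.
suff : c <= s by move=> /(lt_le_trans sc); rewrite ltxx.
apply: sglb => _ [v Av <-]; rewrite real_leNgt ?normr_real//.
by apply/negP => vc; apply: noA; exists v.
Qed.

Section FeatureMap.
Variables (K : numFieldType) (X : Type) (E F : normedModType K).
Variables (phi : X -> Lop F E).

Lemma feature_fun_linear : linear (feature_fun phi).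
Proof.
move=> a mu mu'; apply/funext => x; rewrite /feature_fun.
by have [lin _] := set_valP (phi x); exact: lin.
Qed.

End FeatureMap.

Lemma GRKBS_feature_map (K : numFieldType) (X : Type)
    (E : completeNormedModType K) (B : submodClosed (X -> E))
    (nu : norm_on (fun_space B)) :
  is_GRKBS nu ->
  exists (F : completeNormedModType K) (phi : X -> Lop F E),
    [set f | f \in B] = [set feature_fun phi mu | mu in [set: F]] /\
    forall f : fun_space B,
      infimums [set `|mu| | mu in [set mu : F | \val f = feature_fun phi mu]]
        (nu f).
Proof.
move=> [Bcomplete evB].
pose cM := Uniform_isComplete.Build (normed_by nu) Bcomplete.
pose F : completeNormedModType K := HB.pack (normed_by nu) cM.
have evE x : (ev x : F -> E) \in Lop F E by apply/mem_set; exact: evB.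
pose phi x : Lop F E := SigSub (evE x).
exists F, phi; split.
  apply/seteqP; split => [f fB|_ [mu _ <-]].
    by exists (exist _ f fB).
  exact: (valP mu).
move=> f.
(* Here [feature_fun phi mu] is [mu] itself, so [f] is its only representative and the infimum is
   over one value. *)
suff -> : [set mu : F | \val f = feature_fun phi mu] = [set f].
  by rewrite image_set1 infimums1.
apply/seteqP; split => [mu /= fmu|_ ->//].
by apply/val_inj.
Qed.

Lemma feature_map_GRKBS (K : numFieldType) (hK : real_or_complex K)
    (X : Type) (E : normedModType K) (B : submodClosed (X -> E))
    (nu : norm_on (fun_space B)) (F : completeNormedModType K)
    (phi : X -> Lop F E) :
  [set f | f \in B] = [set feature_fun phi mu | mu in [set: F]] ->
  (forall f : fun_space B,
     infimums [set `|mu| | mu in [set mu : F | \val f = feature_fun phi mu]]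
       (nu f)) ->
  is_GRKBS nu.
Proof.
move=> BE nuE.
have phiB mu : feature_fun phi mu \in B.
  have : [set feature_fun phi mu | mu in [set: F]] (feature_fun phi mu).
    by exists mu.
  by rewrite -BE.
have Bphi (f : fun_space B) : exists mu, \val f = feature_fun phi mu.
  have : [set f | f \in B] (\val f) by exact: (valP f).
  by rewrite BE => -[mu _ <-]; exists mu.
split.
  pose T mu : normed_by nu := exist _ (feature_fun phi mu) (phiB mu).
  have Tlin : linear T.
    by move=> a mu mu'; apply: val_inj; exact: feature_fun_linear.
  pose TM := GRing.isLinear.Build K F (normed_by nu) *:%R T Tlin.
  pose TL : {linear F -> normed_by nu} := HB.pack T TM.
  apply: (quotient_complete K hK F (normed_by nu) TL).
    by move=> mu; apply: (nuE (T mu)).1; exists mu.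
  (* The infimum need not be attained, but any [c] strictly above it exceeds the norm of some
     representative. *)
  move=> v c vc; have [mu vmu] := Bphi v.
  have [|mu' vmu' mu'c] := infimums_norm_lt _ _ _ _ _ (nuE v) vc; first by exists mu.
  by exists mu'; split=> //; exact: val_inj.
move=> x; split; first by [].
have [_ [C hC]] := set_valP (phi x).
(* [C] itself may fail to be positive, even to be real when [F] is trivial. Adding 1 to its norm
   allows division, after which the claim is that [ev x f], in norm and divided by this constant,
   bounds the norms of all representatives of [f] from below. *)
exists (`|C| + 1) => f.
have C0 : 0 < `|C| + 1 by rewrite ltr_wpDl.
rewrite mulrC -ler_pdivrMr//; apply: (nuE f).2 => _ [mu fmu <-].
rewrite ler_pdivrMr// /ev fmu mulrC mulrDl mul1r.
apply: (@le_trans _ _ (`|C| * `|mu|)); last by rewrite lerDl.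
apply: le_trans (hC mu) _; rewrite -[leLHS]ger0_norm ?normrM ?normr_id//.
exact: le_trans (hC mu).
Qed.

Theorem proposition5 (K : numFieldType) (hK : real_or_complex K)
  (X : Type) (E : completeNormedModType K)
  (B : submodClosed (X -> E)) (nu : norm_on (fun_space B)) :
  is_GRKBS nu <->
  exists (F : completeNormedModType K) (phi : X -> Lop F E),
    [set f | f \in B] = [set feature_fun phi mu | mu in [set: F]] /\
    forall f : fun_space B,
      infimums [set `|mu| | mu in [set mu : F | \val f = feature_fun phi mu]]
        (nu f).
Proof.
split; first exact: GRKBS_feature_map.
by move=> [F [phi [BE nuE]]]; exact: feature_map_GRKBS BE nuE.
Qed.
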